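(* Let $d\ge0$ and $l\ge1$ be integers, $\alpha_1,\dots,\alpha_d\in\mathbb{C}$, $i\in\{0,\dots,l-1\}$, and assume that none of the entries of the list $\hat S(i)$ is a non-positive integer. For $m\ge0$ let $$Q_{ml+i}(x)=x^i\;{}_1F_{ld+l-1}\left[\begin{matrix}-m\\ \hat S(i)\end{matrix};-x^l\right].$$ Then the function $$\Phi_i(x,t)=(tx)^i\,e^{t^l}\;{}_0F_{ld+l-1}\left[\begin{matrix}-\\ \hat S(i)\end{matrix};(xt)^l\right]$$ generates the polynomial system $\{Q_{ml+i}(x)\}_{m\ge0}$ by means of the formula (an identity of power series in $t$) $$\Phi_i(x,t)=\sum_{m=0}^{\infty}\frac{t^{ml+i}}{m!}\,Q_{ml+i}(x).$$
   Context: Put $\alpha_{d+1}=0$ and, for $i\in\{0,\dots,l-1\}$, $1\le k\le d+1$, $0\le r\le l-1$, put $S_{k,r}(i)=\frac{\alpha_k+i-r}{l}+1$. Note $S_{d+1,i}(i)=1$. Let $\hat S(i)$ be the list (with multiplicity) of the $ld+l-1$ numbers $S_{k,r}(i)$ over all pairs $(k,r)$ with $1\le k\le d+1$, $0\le r\le l-1$, except $(k,r)=(d+1,i)$. Pochhammer symbol: $(a)_0=1$, $(a)_j=a(a+1)\cdots(a+j-1)$. Generalized hypergeometric series: ${}_pF_q\left[\begin{matrix}a_1,\dots,a_p\\ b_1,\dots,b_q\end{matrix};z\right]=\sum_{j\ge0}\frac{(a_1)_j\cdots(a_p)_j}{(b_1)_j\cdots(b_q)_j}\frac{z^j}{j!}$,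 with ''$-$'' denoting an empty list. (The polynomials $Q_n$ are, up to multiplicative constants, the polynomials $e^{G^l}x^n$ with $G=\rho\prod_{j=1}^d(x\partial_x+\alpha_j+1)\partial_x$ normalized so that $l^{d+1}\rho=1$.) *)

(* Defs.v *)
From HB Require Import structures.
From mathcomp Require Import all_boot all_order all_algebra.
From mathcomp Require Export complex.
From mathcomp Require Import all_classical all_reals all_analysis.

Set Implicit Arguments.
Unset Strict Implicit.
Unset Printing Implicit Defensive.

Import Order.TTheory GRing.Theory Num.Theory.
Import numFieldNormedType.Exports.

Local Open Scope classical_set_scope.
Local Open Scope ring_scope.

(* Series are stated over a numFieldType K, which carries the topology of its
   norm; they are instantiated at K := R[i], the complex numbers over R. *)

Definition pochhammer (K : numFieldType) (a : K) (j : nat) : K :=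
  \prod_(0 <= k < j) (a + k%:R).

(* pFq[as; bs; z], with p = size as and q = size bs. *)
Definition hypergeometric (K : numFieldType) (as_ bs : seq K) (z : K) : K :=
  lim (series (fun j : nat =>
    (\prod_(a <- as_) pochhammer a j) / (\prod_(b <- bs) pochhammer b j)
      * (z ^+ j / (j`!)%:R)) @ \oo).

(* The library's expR is restricted to real arguments. *)
Definition exponential (K : numFieldType) (z : K) : K :=
  lim (series (fun j : nat => z ^+ j / (j`!)%:R) @ \oo).

Definition nonpositive_integer (K : numFieldType) (z : K) : Prop :=
  exists n : nat, z = - n%:R.

(* Indices are 0-based: the ordinal k stands for the index k + 1 of the usual
   list alpha_1, ..., alpha_(d+1), whose last entry alpha_(d+1) is 0. *)
Definition extend_alpha (K : numFieldType) (d : nat) (alpha : 'I_d -> K)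
    (k : 'I_d.+1) : K :=
  if unlift ord_max k is Some j then alpha j else 0.

Definition S_entry (K : numFieldType) (d l : nat) (alpha : 'I_d -> K)
    (i : 'I_l) (k : 'I_d.+1) (r : 'I_l) : K :=
  (extend_alpha alpha k + i%:R - r%:R) / l%:R + 1.

Definition S_hat (K : numFieldType) (d l : nat) (alpha : 'I_d -> K)
    (i : 'I_l) : seq K :=
  [seq S_entry alpha i kr.1 kr.2
     | kr <- enum [pred kr : 'I_d.+1 * 'I_l | kr != (ord_max, i)]].

(* The value at x of Q_(ml+i). *)
Definition Q (K : numFieldType) (d l : nat) (alpha : 'I_d -> K)
    (i : 'I_l) (m : nat) (x : K) : K :=
  x ^+ i * hypergeometric [:: - m%:R] (S_hat alpha i) (- x ^+ l).

Definition Phi (K : numFieldType) (d l : nat) (alpha : 'I_d -> K)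
    (i : 'I_l) (x t : K) : K :=
  (t * x) ^+ i * exponential (t ^+ l)
    * hypergeometric [::] (S_hat alpha i) ((x * t) ^+ l).

(* Main.v *)
Require Import Defs.
From HB Require Import structures.
From mathcomp Require Import all_boot all_order all_algebra.
From mathcomp Require Import complex.
From mathcomp Require Import all_classical all_reals all_analysis.
From mathcomp Require Import ring.

Import Order.TTheory GRing.Theory Num.Theory.
Import numFieldNormedType.Exports.

Import Normc.

Set Implicit Arguments.
Unset Strict Implicit.
Unset Printing Implicit Defensive.

Local Open Scope classical_set_scope.
Local Open Scope ring_scope.
Local Open Scope complex_scope.

(** With a_n = t^(ln) / n! and b_j = (xt)^(lj) / (j! P_j), where P_j is the
    product of (c)_j over the entries c of the parameter list, Phi is
    (tx)^i (sum_n a_n) (sum_j b_j).  Multiplying the two series out gives the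
    coefficients

      sum_(j <= m) b_j a_(m-j)
        = t^(lm) / m! * sum_(j <= m) m (m-1) ... (m-j+1) x^(lj) / (j! P_j),

    and since (-m)_j = (-1)^j m (m-1) ... (m-j+1) vanishes for j > m, the inner
    sum is the terminating series 1F_q[-m; S; -x^l].  So the generating formula
    is the statement that a product of two series is the sum of their Cauchy
    product; the analytic content is that this is legitimate here.

    It is legitimate because both series converge absolutely.  For the
    exponential series this is known over the reals; for the 0F_q series it
    follows by comparison with the exponential one, as 1 / |P_j| is bounded in j
    ([normc_inv_prod_pochhammer_bounded]).  Cauchy's theorem itself
    ([cvg_series_cauchy_product]) is reduced to nonnegative real series: the
    difference between the product of two partial sums and the partial sum of
    the Cauchy product is a sum over the pairs (j, k) with j, k < N <= j + k,
    hence dominated by the same difference for the moduli, and in the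
    nonnegative case the N-th product is squeezed between the N-th and the 2N-th
    partial sums of the Cauchy product. *)

(** * Cauchy products *)

Definition cauchy_product (K : pzRingType) (a b : nat -> K) (n : nat) : K :=
  \sum_(0 <= k < n.+1) a k * b (n - k)%N.

Lemma series_cauchy_product (K : pzRingType) (a b : nat -> K) (N : nat) :
  series (cauchy_product a b) N = \sum_(0 <= j < N) a j * series b (N - j)%N.
Proof.
elim: N => [|N IHN]; first by rewrite /series /= !big_nil.
rewrite seriesSr IHN.
have -> : \sum_(0 <= j < N.+1) a j * series b (N.+1 - j)%N =
          \sum_(0 <= j < N.+1) (a j * series b (N - j)%N + a j * b (N - j)%N).
  rewrite !big_mkord; apply: eq_bigr => j _.
  by rewrite subSn ?seriesSr ?mulrDr // -ltnS.
rewrite big_split /=; congr (_ + _).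
by rewrite big_nat_recr //= subnn [series b 0]big_nil mulr0 addr0.
Qed.

(** The square of pairs (j, k) with j, k < N minus the triangle j + k < N. As the
    right-hand side has no subtraction, moduli can be taken termwise. *)
Lemma cauchy_product_defect (K : pzRingType) (a b : nat -> K) (N : nat) :
  series a N * series b N - series (cauchy_product a b) N =
  \sum_(0 <= j < N) a j * \sum_(N - j <= k < N) b k.
Proof.
rewrite series_cauchy_product [series a N]/series /= mulr_suml -sumrB.
apply: eq_bigr => j _.
by rewrite -mulrBr; congr (_ * _); rewrite sub_series_geq // leq_subr.
Qed.

(** Every pair with j, k < N lies in the triangle j + k < 2N. *)
Lemma series_mul_le_double (R : realFieldType) (a b : nat -> R) (N : nat) :
  (forall n, 0 <= a n) -> (forall n, 0 <= b n) ->
  series a N * series b N <= series (cauchy_product a b) N.*2.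
Proof.
move=> a0 b0; rewrite series_cauchy_product.
have serb_ge0 n : 0 <= series b n by apply: sumr_ge0.
rewrite (@big_cat_nat _ _ _ N) //= -?addnn ?leq_addr //.
apply: (@le_trans _ _ (\sum_(0 <= j < N) a j * series b (N + N - j)%N)).
  rewrite mulr_suml !big_mkord; apply: ler_sum => j _.
  apply: ler_wpM2l => //; apply: nondecreasing_series => //.
  by rewrite -addnBA ?leq_addr // ltnW.
by rewrite lerDl; apply: sumr_ge0 => j _; rewrite mulr_ge0.
Qed.

(** The triangle sums increase and are at most the square sums, hence converge;
    the square sums lie between the triangle sums of sizes N and 2N, so they have
    the same limit. *)
Lemma cauchy_product_defect_cvg0 (R : realType) (a b : nat -> R) :
  (forall n, 0 <= a n) -> (forall n, 0 <= b n) ->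
  cvgn (series a) -> cvgn (series b) ->
  (fun N => series a N * series b N - series (cauchy_product a b) N) @ \oo
    --> (0 : R).
Proof.
move=> a0 b0 cva cvb; set c := cauchy_product a b.
have c0 n : 0 <= c n by apply: sumr_ge0 => k _; rewrite mulr_ge0.
have c_le N : series c N <= series a N * series b N.
  rewrite -subr_ge0 cauchy_product_defect sumr_ge0 // => j _.
  by rewrite mulr_ge0 // sumr_ge0.
have nd (u : nat -> R) : (forall n, 0 <= u n) -> nondecreasing_seq (series u).
  by move=> u0; exact: nondecreasing_series.
have cvc : cvgn (series c).
  apply: nondecreasing_is_cvgn; first exact: nd.
  exists (limn (series a) * limn (series b)) => _ [N _ <-].
  apply: (le_trans (c_le N)); apply: ler_pM; rewrite ?sumr_ge0 //.
  - by apply: nondecreasing_cvgn_le => //; exact: nd.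
  - by apply: nondecreasing_cvgn_le => //; exact: nd.
have cvc2 : (fun N => series c N.*2) @ \oo --> limn (series c).
  apply: (cvg_comp _ _ _ cvc) => A [N _ NA]; exists N => // n /= Nn.
  by apply: NA => /=; rewrite (leq_trans Nn) // -addnn leq_addr.
rewrite -(subrr (limn (series c))); apply: cvgB => //.
apply: (@squeeze_cvgr _ _ _ _ (series c) (fun N => series c N.*2)) => //.
by near=> N; rewrite c_le series_mul_le_double.
Unshelve. all: by end_near. Qed.

(** * Convergence of complex series *)

(** The norm of a complex number is itself complex; [normc] is its real-valued
    form, to which the comparison theorems for real series apply. *)
Lemma normC_def (R : rcfType) (z : R[i]) : `|z| = (normc z)%:C.
Proof. by []. Qed.

Lemma normc_ge0 (R : rcfType) (z : R[i]) : 0 <= normc z.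
Proof. by case: z => a b; exact: sqrtr_ge0. Qed.

Lemma normc_sum (R : rcfType) (I : Type) (r : seq I) (P : pred I)
    (F : I -> R[i]) :
  normc (\sum_(i <- r | P i) F i) <= \sum_(i <- r | P i) normc (F i).
Proof.
by rewrite -lecR -normC_def rmorph_sum /=; exact: ler_norm_sum.
Qed.

Lemma normcX (R : rcfType) (z : R[i]) (n : nat) : normc (z ^+ n) = normc z ^+ n.
Proof. by elim: n => [|n IHn]; rewrite ?normc1 // !exprS normcM IHn. Qed.

Lemma normc_nat (R : rcfType) (n : nat) : normc (n%:R : R[i]) = n%:R.
Proof.
by apply: complexI; rewrite -normC_def normr_nat rmorph_nat.
Qed.

(** Convergence in the complex norm, whose epsilons are complex, from a real
    majorant: a positive epsilon has zero imaginary part. *)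
Lemma cvg_normc (R : realType) (u : nat -> R[i]) (l : R[i]) (v : nat -> R) :
  (forall n, normc (l - u n) <= v n) -> v @ \oo --> 0 ->
  (u : nat -> R[i]^o) @ \oo --> (l : R[i]^o).
Proof.
move=> uv v0; apply/cvgrPdist_lt => e e0.
have [-> Re_gt0] : e = (complex.Re e)%:C /\ 0 < complex.Re e.
  by move: e0; case: e => e e'; rewrite ltcE /= => /andP[/eqP -> ->].
move/cvgr0Pnorm_lt: v0 => /(_ _ Re_gt0).
apply: filterS => n vn; rewrite normC_def ltcR.
by apply: le_lt_trans (uv n) _; apply: le_lt_trans (ler_norm _) vn.
Qed.

Lemma cvg_real_complex (R : realType) (u : nat -> R) (l : R) :
  u @ \oo --> l -> (fun n => (u n)%:C : R[i]^o) @ \oo --> (l%:C : R[i]^o).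
Proof.
move=> ul; apply: (@cvg_normc _ _ _ (fun n => `|l - u n|)) => [n|].
  by rewrite -rmorphB /= expr0n addr0 sqrtr_sqr.
have := cvg_norm (cvgB (@cvg_cst _ l _ \oo _) ul).
by rewrite subrr normr0; exact.
Qed.

(** Absolute convergence implies convergence, coordinatewise: the real and
    imaginary parts are dominated by the modulus. *)
Lemma normc_series_cvg (R : realType) (u : nat -> R[i]) :
  cvgn (series (@normc R \o u)) -> cvgn (series u : nat -> R[i]^o).
Proof.
move=> cvu.
have cv_coord (p : R[i] -> R) : (forall z, `|p z| <= normc z) ->
    cvgn (series (p \o u)).
  move=> p_le; apply: normed_cvg.
  by apply: series_le_cvg cvu => n /=; rewrite ?normc_ge0.
have cvRe : cvgn (series (@complex.Re R \o u)).
  apply: cv_coord => -[p q] /=.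
  by rewrite -sqrtr_sqr ler_wsqrtr // lerDl sqr_ge0.
have cvIm : cvgn (series (@complex.Im R \o u)).
  apply: cv_coord => -[p q] /=.
  by rewrite -sqrtr_sqr ler_wsqrtr // lerDr sqr_ge0.
apply/cvg_ex; exists ((limn (series (@complex.Re R \o u)))%:C +
  'i%C * (limn (series (@complex.Im R \o u)))%:C).
have -> : series u = (fun n => (series (@complex.Re R \o u) n)%:C +
    'i%C * (series (@complex.Im R \o u) n)%:C).
  apply/funext => n; rewrite /series /= !rmorph_sum mulr_sumr -big_split /=.
  by apply: eq_bigr => k _; exact: complexE.
have cvC := @cvg_real_complex R.
exact: (cvgD (cvC _ _ cvRe) (cvgM (cvg_cst _) (cvC _ _ cvIm))).
Qed.

(** Cauchy's theorem: the defect of the complex series is bounded by the defect of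
    the series of moduli. *)
Lemma cvg_series_cauchy_product (R : realType) (a b : nat -> R[i]) :
  cvgn (series (@normc R \o a)) -> cvgn (series (@normc R \o b)) ->
  (series (cauchy_product a b) : nat -> R[i]^o) @ \oo -->
  limn (series a : nat -> R[i]^o) * limn (series b : nat -> R[i]^o).
Proof.
move=> cva cvb.
have defect0 : (fun N => series a N * series b N -
    series (cauchy_product a b) N : R[i]^o) @ \oo --> (0 : R[i]^o).
  have nc_ge0 (u : nat -> R[i]) n : 0 <= (@normc R \o u) n by exact: normc_ge0.
  have := cauchy_product_defect_cvg0 (nc_ge0 a) (nc_ge0 b) cva cvb.
  apply: cvg_normc => N; rewrite sub0r normcN !cauchy_product_defect.
  apply: le_trans (normc_sum _ _ _) _; apply: ler_sum => j _.
  by rewrite normcM ler_wpM2l ?normc_ge0 // normc_sum.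
have -> : series (cauchy_product a b) = (fun N => series a N * series b N -
    (series a N * series b N - series (cauchy_product a b) N)).
  by apply/funext => N; rewrite subKr.
rewrite -[X in _ --> X]subr0; apply: cvgB defect0.
by apply: cvgM; exact: normc_series_cvg.
Qed.

(** * Hypergeometric series *)

(** For k >= |b| + 1 the factor b + k has modulus at least 1, so 1 / |(b)_k| is
    nonincreasing from some index on. *)
Lemma normc_inv_pochhammer_bounded (R : realType) (b : R[i]) :
  exists C : R, forall k, normc (pochhammer b k)^-1 <= C.
Proof.
pose u k := normc (pochhammer b k)^-1.
have u_ge0 k : 0 <= u k by exact: normc_ge0.
have uS k : u k.+1 = u k / normc (b + k%:R).
  by rewrite /u -normcV -normcM -invfM /pochhammer big_nat_recr.
have [M M_gt] : exists M, forall k, (M <= k)%N -> 1 <= normc (b + k%:R).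
  (* |b + k| >= k - |b| *)
  exists (Num.truncn (normc b + 1)).+1; move=> k Mk.
  have b1k : normc b + 1 <= k%:R.
    by apply: (le_trans (ltW (truncnS_gt _))); rewrite ler_nat.
  rewrite -(lerD2l (normc b)) (le_trans b1k) //.
  have -> : (k%:R : R) = normc ((b + k%:R) - b).
    by rewrite addrAC subrr add0r normc_nat.
  by rewrite addrC -[normc b]normcN le_normcD.
(* Summing the first values gives a bound of each of them, among them u M. *)
exists (\sum_(0 <= j < M.+1) u j); elim=> [|k IHk].
  by rewrite big_nat_recl //= lerDl sumr_ge0.
have [kM|Mk] := ltnP k M.
  rewrite (bigD1_seq k.+1) ?mem_index_iota ?iota_uniq //=.
  by rewrite lerDl sumr_ge0.
apply: (le_trans _ IHk); change (u k.+1 <= u k); have bk1 := M_gt k Mk.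
by rewrite uS ler_pdivrMr ?ler_peMr // (lt_le_trans ltr01 bk1).
Qed.

Lemma normc_inv_prod_pochhammer_bounded (R : realType) (bs : seq R[i]) :
  exists C : R, forall k, normc (\prod_(b <- bs) pochhammer b k)^-1 <= C.
Proof.
elim: bs => [|b bs [C IH]].
  by exists 1 => k; rewrite big_nil invr1 normc1.
have [D bD] := normc_inv_pochhammer_bounded b.
exists (D * C) => k; rewrite big_cons invfM normcM.
by rewrite ler_pM ?normc_ge0.
Qed.

Lemma normc_exp_series_cvg (R : realType) (z : R[i]) :
  cvgn (series (@normc R \o (fun n => z ^+ n / (n`!)%:R))).
Proof.
have -> : @normc R \o (fun n => z ^+ n / (n`!)%:R) = exp_coeff (normc z).
  by apply/funext => n /=; rewrite normcM normcV normcX normc_nat.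
exact: is_cvg_series_exp_coeff.
Qed.

Lemma normc_0Fq_series_cvg (R : realType) (bs : seq R[i]) (z : R[i]) :
  cvgn (series (@normc R \o (fun j =>
    (\prod_(a <- [::]) pochhammer a j) / (\prod_(b <- bs) pochhammer b j)
      * (z ^+ j / (j`!)%:R)))).
Proof.
have [C bC] := normc_inv_prod_pochhammer_bounded bs.
apply: (@series_le_cvg _ _ (C *: (@normc R \o (fun n => z ^+ n / (n`!)%:R)))).
- by move=> n; exact: normc_ge0.
- by move=> n; rewrite mulr_ge0 ?normc_ge0 // (le_trans _ (bC 0)) ?normc_ge0.
- by move=> n /=; rewrite big_nil mul1r normcM ler_wpM2r ?normc_ge0.
- by apply: is_cvg_seriesZ; exact: normc_exp_series_cvg.
Qed.

(** Both sides vanish for j > m, as the falling factorial does. *)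
Lemma pochhammerN (K : numFieldType) (m j : nat) :
  pochhammer (- m%:R : K) j = (-1) ^+ j * (m ^_ j)%:R.
Proof.
elim: j => [|j IHj]; first by rewrite /pochhammer big_nil expr0 mul1r.
rewrite /pochhammer big_nat_recr //= -/(pochhammer _ _) IHj ffactnSr.
have [jm|mj] := leqP j m; last by rewrite ffact_small // !(mul0n, mulr0, mul0r).
by rewrite natrM natrB // exprSr; ring.
Qed.

(** The partial sums are constant from the (m + 1)-st on; the signs of (-m)_j and
    of (-z)^j cancel. *)
Lemma hypergeometric_terminating (K : numFieldType) (bs : seq K) (m : nat)
    (z : K) :
  hypergeometric [:: - m%:R] bs (- z) =
  \sum_(0 <= j < m.+1)
    (\prod_(b <- bs) pochhammer b j)^-1 * (m ^_ j)%:R * (z ^+ j / (j`!)%:R).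
Proof.
rewrite /hypergeometric.
set c := BIG_F.
have -> : (fun j : nat => \prod_(a <- [:: - m%:R]) pochhammer a j /
    \prod_(b <- bs) pochhammer b j * ((- z) ^+ j / j`!%:R)) = c.
  apply/funext => j; rewrite big_seq1 pochhammerN /c.
  rewrite [(- z) ^+ j]exprNn.
  transitivity (((-1) ^+ j * (-1) ^+ j) * c j); first by rewrite /c; ring.
  by rewrite -exprMn mulrNN mulr1 expr1n mul1r.
apply: lim_near_cst; first exact: norm_hausdorff.
exists m.+1 => // N /= mN; rewrite /series /= (@big_cat_nat _ _ _ m.+1) //=.
rewrite [X in _ + X]big_nat_cond [X in _ + X]big1 ?addr0 // => j /andP[/andP[mj _] _].
by rewrite /c ffact_small // mulr0 mul0r.
Qed.

(** * The generating formula *)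

Theorem theorem4p1 (R : realType) (d l : nat) (hl : (1 <= l)%N)
    (alpha : 'I_d -> R[i]) (i : 'I_l)
    (hS : forall s : R[i], s \in S_hat alpha i -> ~ nonpositive_integer s) :
  forall x t : R[i],
    series (fun m : nat =>
      t ^+ (m * l + i) / (m`!)%:R * Q alpha i m x : R[i]^o) @ \oo
      --> (Phi alpha i x t : R[i]^o).
Proof.
move=> x t.
pose a n := (t ^+ l) ^+ n / (n`!)%:R : R[i].
pose b j := (\prod_(c <- [::]) pochhammer c j) /
  (\prod_(c <- S_hat alpha i) pochhammer c j)
    * (((x * t) ^+ l) ^+ j / (j`!)%:R) : R[i].
have term m : t ^+ (m * l + i) / (m`!)%:R * Q alpha i m x =
    (t * x) ^+ i * cauchy_product b a m.
  (* Termwise in j, this is m (m-1) ... (m-j+1) / m! = 1 / (m-j)!. *)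
  rewrite /Q hypergeometric_terminating /cauchy_product.
  rewrite !mulr_sumr; apply: eq_big_nat => j /andP[_]; rewrite ltnS => jm.
  have mj0 : ((m - j)`!)%:R != 0 :> R[i] by rewrite pnatr_eq0 -lt0n fact_gt0.
  have mE : (m`!)%:R = (m ^_ j)%:R * ((m - j)`!)%:R :> R[i].
    by rewrite -natrM ffact_fact.
  have tE : t ^+ (m * l + i) = (t ^+ l) ^+ j * (t ^+ l) ^+ (m - j) * t ^+ i.
    by rewrite -exprD subnKC // -exprM mulnC exprD.
  rewrite /a /b big_nil tE mE exprMn; rewrite [(x * t) ^+ l]exprMn exprMn.
  have ff0 : (m ^_ j)%:R != 0 :> R[i] by rewrite pnatr_eq0 -lt0n ffact_gt0.
  have jf0 : (j`!)%:R != 0 :> R[i] by rewrite pnatr_eq0 -lt0n fact_gt0.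
  rewrite mul1r; move: ((\prod_(_ <- _) _)^-1) => P.
  by field; exact/and3P.
have -> : (fun m => t ^+ (m * l + i) / (m`!)%:R * Q alpha i m x) =
    (t * x) ^+ i *: (cauchy_product b a : nat -> R[i]^o).
  by apply/funext => m; rewrite term.
rewrite seriesZ /Phi -mulrA [exponential _ * _]mulrC.
apply: cvgZr; apply: cvg_series_cauchy_product.
- exact: normc_0Fq_series_cvg.
- exact: normc_exp_series_cvg.
Qed.
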